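(* Let $L,R>0$ and let $N$ be a positive integer. Then for any first-order method $A$ that performs at most $N$ calls to its first-order oracle and any dimension $d\geq N+1$, there exist a convex function $w_A\in C^{1,1}_L(\mathbb{R}^d)$ and a point $x_0\in\mathbb{R}^d$ such that $\|x_*-x_0\|\leq R$ for some minimizer $x_*$ of $w_A$, and \[ w_A\big(A(\mathcal{O}_{w_A},x_0)\big)-w_A^*\;\geq\;\frac{LR^2}{2\theta_N^2}, \] where $w_A^*=\min_{x} w_A(x)$ and $\theta_N$ is defined by $\theta_0=1$, $\theta_i=\frac{1+\sqrt{1+4\theta_{i-1}^2}}{2}$ for $i=1,\dots,N-1$, and $\theta_N=\frac{1+\sqrt{1+8\theta_{N-1}^2}}{2}$.
   Context: $C^{1,1}_L(\mathbb{R}^d)$ denotes the set of differentiable functions $f:\mathbb{R}^d\to\mathbb{R}$ whose gradient is Lipschitz continuous with constant $L$ (w.r.t. the Euclidean norm). A first-order oracle $\mathcal{O}_f$ for $f$ is a subroutine that, given a point $x\in\mathbb{R}^d$, returns $(f(x),\nabla f(x))$. A first-order method $A$ is an algorithm that receives a reference (starting) point $x_0\in\mathbb{R}^d$ and gains information on the objective $f$ only by querying $\mathcal{O}_f$: each query point (search point) is chosen based on $x_0$ and the oracle answers obtained so far, and after finitely many queries it outputs an approximate solution $A(\mathcal{O}_f,x_0)\in\mathbb{R}^d$, which likewise depends only on $x_0$ and the oracle answers received. The method has a built-in stopping criterion not depending on external input. *)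

(* Defs.v *)
From HB Require Import structures.
From mathcomp Require Import all_boot all_order all_algebra.
From mathcomp Require Import reals.
Set Implicit Arguments. Unset Strict Implicit. Unset Printing Implicit Defensive.
Import Order.TTheory GRing.Theory Num.Theory.
Local Open Scope ring_scope.

Section Defs.
Variable R : realType.

Definition dotp (d : nat) (u v : 'rV[R]_d) : R := \sum_(i < d) u 0 i * v 0 i.
Definition enorm (d : nat) (v : 'rV[R]_d) : R := Num.sqrt (dotp v v).

Definition is_gradient (d : nat) (f : 'rV[R]_d -> R) (g : 'rV[R]_d -> 'rV[R]_d) : Prop :=
  forall x : 'rV[R]_d, forall eps : R, 0 < eps -> exists2 delta : R, 0 < delta &
    forall h : 'rV[R]_d, enorm h < delta ->
      `| f (x + h) - f x - dotp (g x) h | <= eps * enorm h.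

Definition C11 (d : nat) (L : R) (f : 'rV[R]_d -> R) (g : 'rV[R]_d -> 'rV[R]_d) : Prop :=
  is_gradient f g /\ forall x y, enorm (g x - g y) <= L * enorm (x - y).

Definition convex_fun (d : nat) (f : 'rV[R]_d -> R) : Prop :=
  forall (x y : 'rV[R]_d) (t : R), 0 <= t -> t <= 1 ->
    f (t *: x + (1 - t) *: y) <= t * f x + (1 - t) * f y.

Definition is_minimizer (d : nat) (f : 'rV[R]_d -> R) (xs : 'rV[R]_d) : Prop :=
  forall y, f xs <= f y.

(* First-order method with N oracle calls (deterministic, adaptive):
   the k-th query point is  query k x0 answers  where answers is the list of the
   k oracle answers (f(x_j), grad f(x_j)), j < k, obtained so far; the output is
   out x0 answers_N. *)
Record FOMethod (d : nat) := {
  fom_query : nat -> 'rV[R]_d -> seq (R * 'rV[R]_d) -> 'rV[R]_d;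
  fom_out : 'rV[R]_d -> seq (R * 'rV[R]_d) -> 'rV[R]_d }.

Fixpoint fom_answers (d : nat) (A : FOMethod d) (f : 'rV[R]_d -> R)
    (g : 'rV[R]_d -> 'rV[R]_d) (x0 : 'rV[R]_d) (k : nat) : seq (R * 'rV[R]_d) :=
  match k with
  | 0 => [::]
  | k'.+1 =>
      let ans := fom_answers A f g x0 k' in
      let x := fom_query A k' x0 ans in
      rcons ans (f x, g x)
  end.

Definition fom_run (d : nat) (A : FOMethod d) (N : nat) (f : 'rV[R]_d -> R)
    (g : 'rV[R]_d -> 'rV[R]_d) (x0 : 'rV[R]_d) : 'rV[R]_d :=
  fom_out A x0 (fom_answers A f g x0 N).

Fixpoint theta (i : nat) : R :=
  match i with
  | 0 => 1
  | i'.+1 => (1 + Num.sqrt (1 + 4 * theta i' ^+ 2)) / 2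
  end.

Definition thetaN (N : nat) : R := (1 + Num.sqrt (1 + 8 * theta N.-1 ^+ 2)) / 2.

End Defs.

(* Main.v *)
Require Import Defs.
From HB Require Import structures.
From mathcomp Require Import all_boot all_order all_algebra.
From mathcomp Require Import reals.
From mathcomp Require Import boolp topology normedtype realfun.
From mathcomp Require Import ring lra.
Set Implicit Arguments. Unset Strict Implicit. Unset Printing Implicit Defensive.
Import Order.TTheory GRing.Theory Num.Theory.
Import numFieldNormedType.Exports.
Local Open Scope ring_scope.

(** In orthonormal coordinates u_0, ..., u_N let w be the Moreau envelope of
    max (0, max_i (c_i u_i + b_i)); its gradient at u is the projection of
    L (u + a), a_i = b_i / c_i, onto {p >= 0 | sum_i p_i / c_i <= 1}.  If
    b_i - b_{i+1} = c_i^2 / L, then at a point whose last nonzero coordinate is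
    u_k >= 0 the gradient only involves the coordinates up to k.  Choosing the
    k-th basis vector after the k-th query, so that the query has coordinate
    >= 0 along it and 0 along the later ones, the adversary ensures that the
    output has nonnegative last coordinate, where w >= b_N - c_N^2 / (2 L).  The
    minimum 0 is attained at - a, and maximizing b_N - c_N^2 / (2 L) under
    sum_i a_i^2 = R^2 yields the recursion defining theta. *)

(** * Euclidean inner product and Cauchy-Schwarz *)

Lemma dotpE (R : realType) (d : nat) (u v : 'rV[R]_d) : dotp u v = (u *m v^T) 0 0.
Proof. by rewrite mxE; apply: eq_bigr => i _; rewrite mxE. Qed.

Lemma dotpC (R : realType) (d : nat) (u v : 'rV[R]_d) : dotp u v = dotp v u.
Proof. by apply: eq_bigr => i _; rewrite mulrC. Qed.

Lemma dotpDl (R : realType) (d : nat) (u v w : 'rV[R]_d) :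
  dotp (u + v) w = dotp u w + dotp v w.
Proof. by rewrite !dotpE mulmxDl mxE. Qed.

Lemma dotpNl (R : realType) (d : nat) (u w : 'rV[R]_d) : dotp (- u) w = - dotp u w.
Proof. by rewrite !dotpE mulNmx mxE. Qed.

Lemma dotpZl (R : realType) (d : nat) (a : R) (u w : 'rV[R]_d) :
  dotp (a *: u) w = a * dotp u w.
Proof. by rewrite !dotpE -scalemxAl mxE. Qed.

Lemma dotpDr (R : realType) (d : nat) (u v w : 'rV[R]_d) :
  dotp w (u + v) = dotp w u + dotp w v.
Proof. by rewrite !(dotpC w) dotpDl. Qed.

Lemma dotpNr (R : realType) (d : nat) (u w : 'rV[R]_d) : dotp w (- u) = - dotp w u.
Proof. by rewrite !(dotpC w) dotpNl. Qed.

Lemma dotpZr (R : realType) (d : nat) (a : R) (u w : 'rV[R]_d) :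
  dotp w (a *: u) = a * dotp w u.
Proof. by rewrite !(dotpC w) dotpZl. Qed.

Lemma dotp0l (R : realType) (d : nat) (u : 'rV[R]_d) : dotp 0 u = 0.
Proof. by rewrite dotpE mul0mx mxE. Qed.

Lemma dotp0r (R : realType) (d : nat) (u : 'rV[R]_d) : dotp u 0 = 0.
Proof. by rewrite dotpC dotp0l. Qed.

Definition dotp_lin := (dotpDl, dotpDr, dotpNl, dotpNr, dotpZl, dotpZr).

Lemma dotp_ge0 (R : realType) (d : nat) (u : 'rV[R]_d) : 0 <= dotp u u.
Proof. by apply: sumr_ge0 => i _; rewrite -expr2 sqr_ge0. Qed.

Lemma dotp_eq0 (R : realType) (d : nat) (u : 'rV[R]_d) : dotp u u = 0 -> u = 0.
Proof.
move=> /eqP; rewrite psumr_eq0 => [|i _]; last by rewrite -expr2 sqr_ge0.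
move=> /allP u0; apply/rowP => i; rewrite mxE.
by have := u0 i (mem_index_enum i); rewrite /= mulf_eq0 orbb => /eqP.
Qed.

Lemma dotp_mulmxl (R : realType) (n d : nat) (E : 'M[R]_(n, d)) (u : 'rV_n) (v : 'rV_d) :
  dotp (u *m E) v = dotp u (v *m E^T).
Proof. by rewrite !dotpE trmx_mul trmxK mulmxA. Qed.

Lemma enorm_ge0 (R : realType) (d : nat) (u : 'rV[R]_d) : 0 <= enorm u.
Proof. exact: sqrtr_ge0. Qed.

Lemma sqr_enorm (R : realType) (d : nat) (u : 'rV[R]_d) : enorm u ^+ 2 = dotp u u.
Proof. by rewrite sqr_sqrtr ?dotp_ge0. Qed.

Lemma cauchy_schwarz (R : realType) (d : nat) (u v : 'rV[R]_d) :
  dotp u v <= enorm u * enorm v.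
Proof.
have [u0|u_neq0] := eqVneq (enorm u) 0.
  have /dotp_eq0 -> : dotp u u = 0 by rewrite -sqr_enorm u0 expr0n.
  by rewrite dotp0l mulr_ge0 ?enorm_ge0.
have u_gt0 : 0 < enorm u by rewrite lt_neqAle eq_sym u_neq0 enorm_ge0.
have := dotp_ge0 (enorm v *: u - enorm u *: v).
have [v0|v_neq0] := eqVneq (enorm v) 0.
  have /dotp_eq0 -> : dotp v v = 0 by rewrite -sqr_enorm v0 expr0n.
  by rewrite dotp0r mulr_ge0 ?enorm_ge0.
have v_gt0 : 0 < enorm v by rewrite lt_neqAle eq_sym v_neq0 enorm_ge0.
rewrite !dotp_lin -!sqr_enorm (dotpC v u) => H.
have uv_gt0 := mulr_gt0 u_gt0 v_gt0.
rewrite -(ler_pM2l uv_gt0); lra.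
Qed.

(** * Gradients and convexity from subgradient inequalities *)

(** The subgradient inequalities at [x] and [x + h] trap the first-order remainder between 0 and
    [dotp (g (x + h) - g x) h], which is at most [L * enorm h ^+ 2]. *)
Lemma is_gradient_lipschitz_subgrad (R : realType) (d : nat) (L : R)
    (f : 'rV[R]_d -> R) (g : 'rV[R]_d -> 'rV[R]_d) :
  0 < L -> (forall x y, f x + dotp (g x) (y - x) <= f y) ->
  (forall x y, enorm (g x - g y) <= L * enorm (x - y)) -> is_gradient f g.
Proof.
move=> L0 subg lip x eps eps0; exists (eps / L); first by rewrite divr_gt0.
move=> h hlt.
have lo := subg x (x + h); have hi := subg (x + h) x.
rewrite addrAC subrr add0r in lo.
rewrite opprD addrA subrr add0r dotpNr in hi.
have cs := cauchy_schwarz (g (x + h) - g x) h.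
have lipx := lip (x + h) x; rewrite addrAC subrr add0r in lipx.
rewrite dotpDl dotpNl in cs.
have h0 := enorm_ge0 h.
have Lh : L * enorm h <= eps by rewrite mulrC -ler_pdivlMr // ltW.
have := ler_wpM2r h0 (le_trans lipx Lh).
rewrite ger0_norm; lra.
Qed.

Lemma convex_subgrad (R : realType) (d : nat)
    (f : 'rV[R]_d -> R) (g : 'rV[R]_d -> 'rV[R]_d) :
  (forall x y, f x + dotp (g x) (y - x) <= f y) -> convex_fun f.
Proof.
move=> subg x y t t0 t1; set z := _ + _.
have t1' : 0 <= 1 - t by rewrite subr_ge0.
have := lerD (ler_wpM2l t0 (subg z x)) (ler_wpM2l t1' (subg z y)).
apply: le_trans; rewrite !mulrDr addrACA -mulrDl subrKC mul1r.
rewrite -!dotpZr -dotpDr !scalerBr addrACA -opprD -scalerDl subrKC scale1r subrr.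
by rewrite dotp0r addr0.
Qed.

(** * Projection onto a weighted simplex *)

Definition weighted_simplex (R : realType) (n : nat) (c : 'rV[R]_n) (p : 'rV[R]_n) : Prop :=
  (forall i, 0 <= p 0 i) /\ \sum_(i < n) p 0 i / c 0 i <= 1.

(** The KKT form of the projection of [v] onto the weighted simplex, [lam] being the multiplier of
    the sum constraint. *)
Definition threshold (R : realType) (n : nat) (c v : 'rV[R]_n) (lam : R) : 'rV[R]_n :=
  \row_i Num.max 0 (v 0 i - lam / c 0 i).

(** Either [lam = 0] is feasible, or the constraint sum, continuous in [lam], exceeds 1 at 0 and
    vanishes further on, hence equals 1 in between. The last clause is complementary slackness. *)
Lemma exists_threshold (R : realType) (n : nat) (c v : 'rV[R]_n) :
  (forall i, 0 < c 0 i) ->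
  exists lam, [/\ 0 <= lam, weighted_simplex c (threshold c v lam) &
    lam * (1 - \sum_(i < n) threshold c v lam 0 i / c 0 i) = 0].
Proof.
move=> c0; pose f lam := \sum_(i < n) threshold c v lam 0 i / c 0 i.
have simplex lam : f lam <= 1 -> weighted_simplex c (threshold c v lam).
  by split=> // i; rewrite mxE le_max lexx.
have [f0|f0] := leP (f 0) 1.
  by exists 0; rewrite mul0r; split => //; exact: simplex.
(* [b] bounds every [v 0 i * c 0 i], so all coordinates are cut to 0 at [lam = b]. *)
pose b := \sum_i `|v 0 i * c 0 i|.
have b0 : 0 <= b by apply: sumr_ge0.
have fb : f b = 0.
  apply: big1 => i _; rewrite mxE max_l ?mul0r // subr_le0 ler_pdivlMr //.
  apply: le_trans (ler_norm _) _; rewrite /b (bigD1 i) //= lerDl.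
  exact: sumr_ge0.
have fcont : continuous f.
  have -> : f = fun lam => \sum_(i <- index_enum 'I_n)
      Num.max 0 (v 0 i - lam / c 0 i) / c 0 i.
    by apply/funext => lam; apply: eq_bigr => i _; rewrite mxE.
  elim: (index_enum _) => [|i s IHs] x.
    have -> : (fun lam : R => \sum_(i <- [::])
      Num.max 0 (v 0 i - lam / c 0 i) / c 0 i) = (fun=> 0 : R).
      by apply/funext => lam; rewrite big_nil.
    exact: cst_continuous.
  have -> : (fun lam : R => \sum_(i <- i :: s)
      Num.max 0 (v 0 i - lam / c 0 i) / c 0 i) =
      (fun lam => Num.max 0 (v 0 i - lam / c 0 i) / c 0 i) \+
      (fun lam => \sum_(i <- s) Num.max 0 (v 0 i - lam / c 0 i) / c 0 i).
    by apply/funext => lam; rewrite big_cons.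
  apply: continuousD; last exact: IHs.
  apply: continuousM; last exact: cst_continuous.
  have gcont : continuous (fun lam : R => v 0 i - lam / c 0 i).
    move=> y; apply: cvgB; first exact: cvg_cst.
    by apply: cvgM; [exact: cvg_id | exact: cvg_cst].
  exact: (max_fun_continuous (@cst_continuous _ _ (0 : R)) gcont).
have [||lam] := @IVT R f 0 b 1 b0.
- exact: continuous_subspaceT.
- by rewrite fb (min_r (ltW (lt_trans ltr01 f0))) (max_l (ltW (lt_trans ltr01 f0))) ler01 ltW.
rewrite in_itv /= => /andP[lam0 _] flam; exists lam; split => //.
  by apply: simplex; rewrite flam.
by rewrite [X in 1 - X]flam subrr mulr0.
Qed.

(** The residual is [lam / c 0 i] at positive coordinates of the threshold and at most that
    elsewhere. As [q] is nonnegative, the pairing is at most [lam] times a difference of constraint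
    sums, and slackness concludes. *)
Lemma threshold_variational (R : realType) (n : nat) (c v q : 'rV[R]_n) (lam : R) :
  (forall i, 0 < c 0 i) -> 0 <= lam -> weighted_simplex c q ->
  lam * (1 - \sum_(i < n) threshold c v lam 0 i / c 0 i) = 0 ->
  dotp (v - threshold c v lam) (q - threshold c v lam) <= 0.
Proof.
move=> c0 lam0 [q0 qsum] slack; set p := threshold c v lam.
apply: (@le_trans _ _ (\sum_i lam * (q 0 i / c 0 i - p 0 i / c 0 i))).
  apply: ler_sum => i _; rewrite !mxE.
  have [le0|gt0] := leP (v 0 i - lam / c 0 i) 0.
    by rewrite mul0r !subr0 mulrCA mulrC ler_wpM2l // -subr_le0.
  by rewrite le_eqVlt; apply/predU1P; left; ring.
rewrite -mulr_sumr sumrB mulrBr.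
have := ler_wpM2l lam0 qsum; move: slack; rewrite -/p mulrBr mulr1; lra.
Qed.

(** If coordinate [i] were positive, then [lam < v 0 i * c 0 i], and coordinate [k] alone would
    contribute more than 1 to the constraint sum. *)
Lemma threshold_eq0 (R : realType) (n : nat) (c v : 'rV[R]_n) (lam : R) (i k : 'I_n) :
  (forall i, 0 < c 0 i) -> weighted_simplex c (threshold c v lam) ->
  v 0 i * c 0 i + c 0 k ^+ 2 <= v 0 k * c 0 k -> threshold c v lam 0 i = 0.
Proof.
move=> c0 [p0 psum] vik; rewrite mxE max_l // subr_le0 ler_pdivlMr //.
rewrite leNgt; apply/negP => lam_lt; move: psum; apply/negP; rewrite -ltNge.
apply: (@lt_le_trans _ _ (threshold c v lam 0 k / c 0 k)).
  rewrite ltr_pdivlMr // mul1r mxE lt_max; apply/orP; right.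
  rewrite ltrBrDl -ltrBrDr ltr_pdivrMr // mulrBl -expr2; lra.
by rewrite (bigD1 k) //= lerDl sumr_ge0 // => j _; rewrite divr_ge0 // ltW.
Qed.

Definition is_projection (R : realType) (n : nat) (S : 'rV[R]_n -> Prop)
    (P : 'rV[R]_n -> 'rV[R]_n) : Prop :=
  forall v, S (P v) /\ forall q, S q -> dotp (v - P v) (q - P v) <= 0.

Lemma exists_simplex_projection (R : realType) (n : nat) (c : 'rV[R]_n) :
  (forall i, 0 < c 0 i) ->
  exists2 P, is_projection (weighted_simplex c) P &
    forall (v : 'rV_n) i k, v 0 i * c 0 i + c 0 k ^+ 2 <= v 0 k * c 0 k -> P v 0 i = 0.
Proof.
move=> c0; have [lam lamP] := choice (fun v => exists_threshold v c0).
exists (fun v => threshold c v (lam v)) => [v|v i k].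
  have [lam0 Sv slack] := lamP v; split=> // q Sq.
  exact: threshold_variational.
by have [_ Sv _] := lamP v; exact: threshold_eq0.
Qed.

(** * Convexity, smoothness and minimum of the envelope *)

(* For P the projection onto S, this is the maximum of <q, u + a> - |q|^2 / (2 L)
   over q in S: the conjugate form of a Moreau envelope. *)
Definition envelope (R : realType) (n : nat) (L : R) (P : 'rV[R]_n -> 'rV[R]_n)
    (a u : 'rV[R]_n) : R :=
  let v := L *: (u + a) in (dotp (P v) v - dotp (P v) (P v) / 2) / L.

(** With [p = P v], [L] times the gap is [dotp (q - p) (q - p) / 2 - dotp (v - p) (q - p)], a sum of
    two nonnegative terms. *)
Lemma envelope_ge (R : realType) (n : nat) (L : R) (S : 'rV[R]_n -> Prop)
    (P : 'rV[R]_n -> 'rV[R]_n) (a u q : 'rV[R]_n) :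
  0 < L -> is_projection S P -> S q ->
  dotp q (u + a) - dotp q q / (2 * L) <= envelope L P a u.
Proof.
move=> L0 projP Sq; rewrite /envelope; set v := L *: _; set p := P v.
have -> : dotp q (u + a) - dotp q q / (2 * L) = (dotp q v - dotp q q / 2) / L.
  by rewrite dotpZr; field; exact: lt0r_neq0.
rewrite ler_pM2r ?invr_gt0 //.
have := (projP v).2 q Sq; have := dotp_ge0 (q - p); rewrite -/p.
clearbody p v; rewrite !dotp_lin.
rewrite (dotpC v q) (dotpC v p) (dotpC p q); lra.
Qed.

(** The maximizer at [u] is a competitor at [u'], and the maximized expression is affine in the
    point. *)
Lemma envelope_subgrad (R : realType) (n : nat) (L : R) (S : 'rV[R]_n -> Prop)
    (P : 'rV[R]_n -> 'rV[R]_n) (a u u' : 'rV[R]_n) :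
  0 < L -> is_projection S P ->
  envelope L P a u + dotp (P (L *: (u + a))) (u' - u) <= envelope L P a u'.
Proof.
move=> L0 projP; apply: le_trans (envelope_ge a u' L0 projP (projP _).1).
rewrite /envelope !dotp_lin le_eqVlt; apply/predU1P; left.
by field; exact: lt0r_neq0.
Qed.

(** Add the two variational inequalities, each tested at the other projection. *)
Lemma projection_cocoercive (R : realType) (n : nat) (S : 'rV[R]_n -> Prop)
    (P : 'rV[R]_n -> 'rV[R]_n) (v v' : 'rV[R]_n) :
  is_projection S P -> dotp (P v - P v') (P v - P v') <= dotp (P v - P v') (v - v').
Proof.
move=> projP; have := (projP v).2 _ (projP v').1; have := (projP v').2 _ (projP v).1.
rewrite !dotp_lin !(dotpC v) !(dotpC v') (dotpC (P v') (P v)); lra.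
Qed.

(** As the rows of [E] are orthonormal, cocoercivity bounds the squared norm of the gradient gap by
    [L * dotp gap (x - y)]; Cauchy-Schwarz then allows cancelling one factor [enorm gap]. *)
Lemma envelope_C11 (R : realType) (n d : nat) (L : R) (S : 'rV[R]_n -> Prop)
    (P : 'rV[R]_n -> 'rV[R]_n) (a : 'rV[R]_n) (E : 'M[R]_(n, d)) :
  0 < L -> is_projection S P -> E *m E^T = 1%:M ->
  let w := fun y : 'rV_d => envelope L P a (y *m E^T) in
  convex_fun w /\ C11 L w (fun y => P (L *: (y *m E^T + a)) *m E).
Proof.
move=> L0 projP EE w.
have subg x y : w x + dotp (P (L *: (x *m E^T + a)) *m E) (y - x) <= w y.
  by rewrite dotp_mulmxl mulmxBl; exact: envelope_subgrad L0 projP.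
have lip x y : enorm (P (L *: (x *m E^T + a)) *m E - P (L *: (y *m E^T + a)) *m E)
    <= L * enorm (x - y).
  set v := L *: _; set v' := L *: _; set gap := _ - _.
  have gapE : gap = (P v - P v') *m E by rewrite mulmxBl.
  have [->|gap_neq0] := eqVneq (enorm gap) 0; first by rewrite mulr_ge0 ?enorm_ge0 ?ltW.
  have gap_gt0 : 0 < enorm gap by rewrite lt_neqAle eq_sym gap_neq0 enorm_ge0.
  rewrite -(ler_pM2r gap_gt0) -expr2 sqr_enorm.
  apply: (@le_trans _ _ (L * dotp gap (x - y))).
    rewrite {1 2}gapE dotp_mulmxl -mulmxA EE mulmx1.
    apply: le_trans (projection_cocoercive _ _ projP) _.
    rewrite /v /v' -scalerBr opprD addrACA subrr addr0 -mulmxBl dotpZr.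
    by rewrite -dotp_mulmxl -gapE.
  by rewrite -mulrA ler_pM2l // [leRHS]mulrC; exact: cauchy_schwarz.
split; first exact: convex_subgrad subg.
by split=> //; exact: is_gradient_lipschitz_subgrad L0 subg lip.
Qed.

(** The competitor 0 gives [w >= 0], while at [- a *m E] the argument of [P] is 0 and only the
    nonpositive quadratic term is left. *)
Lemma envelope_minimizer (R : realType) (n d : nat) (L : R) (S : 'rV[R]_n -> Prop)
    (P : 'rV[R]_n -> 'rV[R]_n) (a : 'rV[R]_n) (E : 'M[R]_(n, d)) :
  0 < L -> is_projection S P -> S 0 -> E *m E^T = 1%:M ->
  let w := fun y : 'rV_d => envelope L P a (y *m E^T) in
  w (- a *m E) <= 0 /\ is_minimizer w (- a *m E).
Proof.
move=> L0 projP S0 EE w.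
have w_ge0 y : 0 <= w y.
  have := envelope_ge a (y *m E^T) L0 projP S0.
  by rewrite !dotp0l mul0r subr0.
have w_le0 : w (- a *m E) <= 0.
  rewrite /w /envelope -mulmxA EE mulmx1 addNr scaler0.
  rewrite dotp0r add0r pmulr_lle0 ?invr_gt0 //.
  by rewrite oppr_le0 divr_ge0 ?dotp_ge0.
by split=> // y; exact: le_trans w_le0 (w_ge0 y).
Qed.

(** * Orthonormal frames adapted to the queries *)

Definition ends_at (R : realType) (n : nat) (k : nat) (u : 'rV[R]_n) : Prop :=
  (forall i : 'I_n, (k < i)%N -> u 0 i = 0) /\
  (forall i : 'I_n, i = k :> nat -> 0 <= u 0 i).

Definition supported_below (R : realType) (n : nat) (k : nat) (u : 'rV[R]_n) : Prop :=
  forall i : 'I_n, (k <= i)%N -> u 0 i = 0.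

(** The reflection along [v] sends the tail [t] of [z] to [enorm t] times the [k]-th basis vector.
    It fixes vectors supported below [k] because [v] vanishes there. *)
Lemma householder (R : realType) (n : nat) (k : 'I_n) (z : 'rV[R]_n) :
  exists H : 'M[R]_n, [/\ H^T = H, H *m H = 1%:M,
    forall u, supported_below k u -> u *m H = u & ends_at k (z *m H)].
Proof.
pose t : 'rV[R]_n := \row_i (if (k <= i)%N then z 0 i else 0).
pose v := t - enorm t *: delta_mx 0 k.
have vlow (i : 'I_n) : (i < k)%N -> v 0 i = 0.
  move=> ik; rewrite !mxE leqNgt ik /=.
  by case: eqP => [ki|_]; [rewrite ki ltnn in ik | rewrite mulr0 subr0].
have vhigh (i : 'I_n) : (k < i)%N -> v 0 i = z 0 i.
  move=> ki; have /negPf ik : i != k by rewrite -val_eqE gtn_eqF.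
  by rewrite !mxE (ltnW ki) ik andbF mulr0 subr0.
pose H := 1%:M - (2 / dotp v v) *: (v^T *m v).
have mulH u : u *m H = u - (2 * dotp u v / dotp v v) *: v.
  rewrite mulmxBr mulmx1 -scalemxAr mulmxA [u *m _]mx11_scalar mul_scalar_mx.
  by rewrite scalerA -dotpE mulrAC.
have dotk u : dotp u (delta_mx 0 k) = u 0 k.
  rewrite /dotp (bigD1 k) //= mxE !eqxx mulr1 big1 ?addr0 // => i ik.
  by rewrite mxE (negPf ik) andbF mulr0.
have zt : dotp z t = dotp t t.
  by apply: eq_bigr => i _; rewrite !mxE; case: ifP => // _; rewrite !mulr0.
have tk : t 0 k = z 0 k by rewrite mxE leqnn.
have dotv u : dotp u v = dotp u t - enorm t * u 0 k by rewrite !dotp_lin dotk.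
have vk : v 0 k = z 0 k - enorm t by rewrite -tk !mxE leqnn !eqxx mulr1.
have vv : dotp v v = 2 * dotp z v.
  by rewrite dotv (dotpC v t) !dotv vk zt tk -sqr_enorm; ring.
clearbody v.
exists H; split.
- by rewrite /H linearB /= trmx1 linearZ /= trmx_mul trmxK.
- apply/row_matrixP => i; rewrite row_mul.
  set u := row i H; have -> : u = row i 1%:M *m H by rewrite -row_mul mul1mx.
  move: (row i 1%:M) => r; rewrite !mulH !dotp_lin.
  rewrite -addrA -opprD -scalerDl.
  (* When [v] is 0, division by 0 returns 0 and [H] is the identity. *)
  have [v0|v_neq0] := eqVneq (dotp v v) 0.
    by rewrite v0 invr0 !mulr0 addr0 scale0r subr0.
  rewrite [X in X *: v](_ : _ = 0) ?scale0r ?subr0 //.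
  by field.
- move=> u ulow; rewrite mulH.
  have -> : dotp u v = 0.
    apply: big1 => i _; have [ki|ik] := leqP k i; first by rewrite ulow ?mul0r.
    by rewrite vlow ?mulr0.
  by rewrite mulr0 mul0r scale0r subr0.
- have -> : z *m H = z - v.
    rewrite mulH -vv; have [/dotp_eq0 ->|v_neq0] := eqVneq (dotp v v) 0.
      by rewrite scaler0.
    by rewrite divff // scale1r.
  split=> i; rewrite !mxE.
    by move/vhigh ->; rewrite subrr.
  by move=> /val_inj ->; rewrite vk opprB subrKC enorm_ge0.
Qed.

(* Since query j only sees the first j + 1 rows of E, the remaining rows may be
   rotated afterwards without changing any previous answer. *)
Lemma resisting_frame (R : realType) (n d : nat) (A : FOMethod R d) (x0 : 'rV[R]_d)
    (F : 'rV[R]_n -> R) (P : 'rV[R]_n -> 'rV[R]_n) (k : nat) :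
  (forall (j : nat) u, ends_at j u -> supported_below j.+1 (P u)) ->
  (n <= d)%N -> (k <= n)%N ->
  exists2 E : 'M[R]_(n, d), E *m E^T = 1%:M &
    forall j, (j < k)%N ->
      ends_at j (fom_query A j x0 (fom_answers A (fun y => F (y *m E^T))
        (fun y => P (y *m E^T) *m E) x0 j) *m E^T).
Proof.
move=> chainP nd; elim: k => [_|k IHk kn].
  exists (pid_mx n) => //.
  by rewrite tr_pid_mx mul_pid_mx minnn (minn_idPr nd) pid_mx_1.
have [E EE qE] := IHk (ltnW kn).
pose q E j := fom_query A j x0 (fom_answers A (fun y => F (y *m E^T))
        (fun y => P (y *m E^T) *m E) x0 j).
have [H [HT HH fixH endH]] := householder (Ordinal kn) (q E k *m E^T).
have fixq j : (j < k)%N -> q E j *m E^T *m H = q E j *m E^T.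
  move=> jk; apply: fixH => i ki.
  by apply: (qE j jk).1; exact: leq_trans jk ki.
(* The answers preceding query [k] involve only queries [j < k], whose coordinates and gradients are
   fixed by [H]. Hence [j = k] is included and query [k] itself is unchanged by the rotation. *)
have ansE j : (j <= k)%N ->
  fom_answers A (fun y => F (y *m (H *m E)^T)) (fun y => P (y *m (H *m E)^T) *m (H *m E)) x0 j
  = fom_answers A (fun y => F (y *m E^T)) (fun y => P (y *m E^T) *m E) x0 j.
  elim: j => //= j IHj jk; rewrite IHj ?(ltnW jk) // -/(q E j).
  rewrite trmx_mul HT !mulmxA fixq // fixH // => i ki.
  by apply: (chainP j _ (qE j jk)); exact: leq_trans jk ki.
exists (H *m E); first by rewrite trmx_mul HT -mulmxA (mulmxA E) EE mul1mx.
move=> j; rewrite ltnS => jk; rewrite ansE // -/(q E j) trmx_mul HT mulmxA.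
move: jk; rewrite leq_eqVlt => /predU1P[->//|jk].
by rewrite fixq //; exact: qE.
Qed.

(** * The theta recursion and the optimal parameters *)

(** Taking [x] as the previous squared theta, or twice it, covers both the regular recursion and the
    modified last step. *)
Lemma quadratic_root (R : realType) (x : R) : 0 <= x ->
  let t := (1 + Num.sqrt (1 + 4 * x)) / 2 in 1 <= t /\ t ^+ 2 - t = x.
Proof.
move=> x0 t; have s1 : 1 <= Num.sqrt (1 + 4 * x).
  by rewrite -[leLHS]sqrtr1 ler_wsqrtr // lerDl mulr_ge0.
have sE : Num.sqrt (1 + 4 * x) ^+ 2 = 1 + 4 * x by rewrite sqr_sqrtr; lra.
by split; rewrite /t; [lra | rewrite expr_div_n; nra].
Qed.

Lemma theta_ge1 (R : realType) (i : nat) : 1 <= theta R i.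
Proof. by case: i => //= i; have [] := quadratic_root (sqr_ge0 (theta R i)). Qed.

Lemma thetaS (R : realType) (i : nat) :
  theta R i.+1 ^+ 2 - theta R i.+1 = theta R i ^+ 2.
Proof. by have [] := quadratic_root (sqr_ge0 (theta R i)). Qed.

Lemma thetaN_spec (R : realType) (N : nat) :
  1 <= thetaN R N /\ thetaN R N ^+ 2 - thetaN R N = 2 * theta R N.-1 ^+ 2.
Proof.
have := quadratic_root (mulr_ge0 (ler0n R 2) (sqr_ge0 (theta R N.-1))).
by rewrite /= mulrA -natrM.
Qed.

(* The ratios b i / b i.+1 minimize the sum for a prescribed last value b k. *)
Lemma exists_chain_levels (R : realType) (k : nat) (beta : R) : 0 < beta ->
  exists b : nat -> R, [/\ b k = beta, forall i, (i < k)%N -> b i.+1 < b i &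
    \sum_(i < k) b i ^+ 2 / (b i - b i.+1) = 4 * (theta R k ^+ 2 - theta R k) * beta].
Proof.
elim: k beta => [|k IHk] beta beta0.
  by exists (fun=> beta); split=> //; rewrite big_ord0 /= expr1n subrr mulr0 mul0r.
have t1 := theta_ge1 R k; have tS := thetaS R k; set t := theta R k in t1 tS.
(* The ratio [x = b k / beta] minimizes [4 * (t ^+ 2 - t) * x + x ^+ 2 / (x - 1)], with minimum
   [4 * t ^+ 2]. *)
have [|b [bk bdec bsum]] := IHk (2 * t / (2 * t - 1) * beta).
  by rewrite mulr_gt0 // divr_gt0; lra.
have beta_lt : beta < b k by rewrite bk ltr_pMl // ltr_pdivlMr; lra.
exists (fun i => if (i <= k)%N then b i else beta); split.
- by rewrite ltnn.
- move=> i; rewrite ltnS => ik; rewrite ik.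
  by move: ik; rewrite leq_eqVlt => /predU1P[->|ik]; rewrite ?ltnn // ik bdec.
- rewrite big_ord_recr /= leqnn ltnn.
  under eq_bigr => i _ do rewrite (ltnW (ltn_ord i)) (ltn_ord i).
  rewrite bsum bk tS -/t; field; apply/andP; split; lra.
Qed.

(* The levels and slopes are the b_i and c_i of the affine pieces c_i u_i + b_i. *)
Lemma exists_chain_parameters (R : realType) (L Rad : R) (N : nat) :
  0 < L -> 0 < Rad -> (0 < N)%N ->
  exists level slope : nat -> R,
    [/\ forall i, 0 < slope i,
        forall i k, (k < i)%N -> (i <= N)%N ->
          L * level i + slope k ^+ 2 <= L * level k,
        \sum_(i < N.+1) (level i / slope i) ^+ 2 = Rad ^+ 2 &
        level N - slope N ^+ 2 / (2 * L) = L * Rad ^+ 2 / (2 * thetaN R N ^+ 2)].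
Proof.
move=> L0 Rad0 N0; have [s1 sE] := thetaN_spec R N; set s := thetaN R N in s1 sE *.
(* Normalizes the sum of squares, which comes out as [beta * s * (2 * s - 1) / L], to [Rad ^+ 2]. *)
pose beta := L * Rad ^+ 2 / (s * (2 * s - 1)).
have s0 : 0 < s by lra.
have s21 : 0 < 2 * s - 1 by lra.
have beta0 : 0 < beta by apply: divr_gt0; apply: mulr_gt0 => //; exact: exprn_gt0.
have [b [bN bdec bsum]] := exists_chain_levels N beta0.
(* Squared slopes. Before [N] the separation of consecutive levels is tight; the last one maximizes
   the final bound under the norm constraint, which gives the equation for [s]. *)
pose sq i := if (i < N)%N then L * (b i - b i.+1) else L * beta / s.
have sq0 i : 0 < sq i.
  rewrite /sq; case: ifP => iN; last by rewrite divr_gt0 // mulr_gt0.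
  by rewrite mulr_gt0 // subr_gt0 bdec.
have sqE i : Num.sqrt (sq i) ^+ 2 = sq i by rewrite sqr_sqrtr ?ltW.
have sqN : sq N = L * beta / s by rewrite /sq ltnn.
exists b, (fun i => Num.sqrt (sq i)); split.
- by move=> i; rewrite sqrtr_gt0.
- move=> i k ki iN; rewrite sqE /sq (leq_trans ki iN) -mulrDr ler_pM2l //.
  suff : b i <= b k.+1 by lra.
  move: iN; rewrite -(subnKC ki); elim: (i - k.+1)%N => [|m IHm]; first by rewrite addn0.
  by rewrite addnS => mN; exact: le_trans (ltW (bdec _ mN)) (IHm (ltnW mN)).
- under eq_bigr => i _ do rewrite expr_div_n sqE.
  rewrite big_ord_recr /= sqN bN.
  have -> : \sum_(i < N) b i ^+ 2 / sq i = (\sum_(i < N) b i ^+ 2 / (b i - b i.+1)) / L.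
    rewrite mulr_suml; apply: eq_bigr => i _.
    by rewrite /sq ltn_ord invfM mulrCA mulrC.
  rewrite bsum -[in theta R N](prednK N0) thetaS.
  have -> : 4 * theta R N.-1 ^+ 2 = 2 * (s ^+ 2 - s) by rewrite sE; ring.
  by rewrite /beta; field; rewrite !lt0r_neq0.
- by rewrite sqE sqN bN /beta; field; rewrite !lt0r_neq0.
Qed.

Theorem theorem3 (R : realType) (L Rad : R) (N : nat) :
  0 < L -> 0 < Rad -> (0 < N)%N ->
  forall (d : nat), (N.+1 <= d)%N ->
  forall (A : FOMethod R d),
  exists (w : 'rV[R]_d -> R) (g : 'rV[R]_d -> 'rV[R]_d) (x0 xs : 'rV[R]_d),
    [/\ convex_fun w, C11 L w g, is_minimizer w xs, enorm (xs - x0) <= Rad &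
        w (fom_run A N w g x0) - w xs >= L * Rad ^+ 2 / (2 * thetaN R N ^+ 2)].
Proof.
move=> L0 Rad0 N0 d Nd A.
have [b [c [c0 bc absum bN]]] := exists_chain_parameters L0 Rad0 N0.
pose cv : 'rV[R]_N.+1 := \row_i c i; pose a : 'rV[R]_N.+1 := \row_i (b i / c i).
have cv0 i : 0 < cv 0 i by rewrite mxE.
have ac i : a 0 i * cv 0 i = b i by rewrite !mxE divfK // lt0r_neq0.
have [P projP Pzero] := exists_simplex_projection cv0.
(* Since [u] has coordinate [j] nonnegative and later ones 0, the level gap [bc] makes index [j]
   dominate every later index in the sense of [Pzero]. *)
have chainP j u : ends_at j u -> supported_below j.+1 (P (L *: (u + a))).
  move=> [uz uj] i ji; have jN : (j < N.+1)%N := ltn_trans ji (ltn_ord i).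
  apply: (Pzero _ i (Ordinal jN)).
  have uL k : (L *: (u + a)) 0 k * cv 0 k = L * (u 0 k * cv 0 k + b k).
    by rewrite 2!mxE -mulrA mulrDl ac.
  rewrite !uL uz // mul0r add0r [cv 0 _]mxE /= mulrDr.
  apply: le_trans (bc _ _ ji (ltn_ord i)) _.
  by rewrite lerDr !mulr_ge0 ?uj // ltW.
(* The output is treated as one more query. *)
pose A' := Build_FOMethod
  (fun j => if j == N then fom_out A else fom_query A j) (fom_out A).
have [E EE qE] := resisting_frame A' 0 (envelope L P a) chainP Nd (leqnn _).
pose w (y : 'rV[R]_d) := envelope L P a (y *m E^T).
pose g (y : 'rV[R]_d) := P (L *: (y *m E^T + a)) *m E.
have ansE j : (j <= N)%N -> fom_answers A' w g 0 j = fom_answers A w g 0 j.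
  by elim: j => //= j IHj jN; rewrite IHj ?(ltnW jN) // ltn_eqF.
have S0 : weighted_simplex cv 0.
  by split=> [i|]; rewrite ?mxE // big1 // => i _; rewrite mxE mul0r.
have [w_le0 w_min] := envelope_minimizer a L0 projP S0 EE.
have [w_convex w_C11] := envelope_C11 a L0 projP EE.
exists w, g, 0, (- a *m E); split => //.
  rewrite subr0 /enorm dotp_mulmxl -mulmxA EE mulmx1 dotpNl dotpNr opprK.
  rewrite /dotp (eq_bigr (fun i : 'I_N.+1 => (b i / c i) ^+ 2)) => [|i _].
    by rewrite absum sqrtr_sqr gtr0_norm.
  by rewrite mxE expr2.
apply: (@le_trans _ _ (w (fom_run A N w g 0))); last by rewrite lerBrDl gerDr.
have [_ /(_ ord_max erefl)] := qE N (ltnSn N).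
rewrite /= eqxx -/w -/g ansE // -/(fom_run A N w g 0); set u := _ *m E^T => uN.
(* The vertex of the simplex on the last axis: as a competitor it gives [c N * u 0 ord_max + b N - c
   N ^+ 2 / (2 * L)]. *)
pose q : 'rV[R]_N.+1 := c N *: delta_mx 0 ord_max.
have dotq v : dotp q v = c N * v 0 ord_max.
  rewrite dotpZl /dotp (bigD1 ord_max) //= mxE !eqxx mul1r big1 ?addr0 // => i iN.
  by rewrite mxE (negPf iN) andbF mul0r.
have qN i : q 0 i = if i == ord_max then c N else 0.
  by rewrite !mxE /=; case: eqP; rewrite ?mulr1 ?mulr0.
have Sq : weighted_simplex cv q.
  split=> [i|]; first by rewrite qN; case: eqP => // _; exact: ltW.
  rewrite (bigD1 ord_max) //= big1 => [|i iN]; rewrite qN ?(negPf iN) ?mul0r //.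
  by rewrite eqxx mxE addr0 divff // lt0r_neq0.
apply: le_trans (envelope_ge a u L0 projP Sq).
rewrite -bN !dotq qN eqxx mxE mulrDr -expr2 lerD2r.
by have := ac ord_max; rewrite [cv _ _]mxE mulrC => ->; rewrite lerDr mulr_ge0 // ltW.
Qed.
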